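(* If $\mathcal{B}$ is a left-sided reproducing kernel Banach space of functions on $\Omega$ with the left-sided reproducing kernel $K\in L_0(\Omega\times\Omega')$, then $\operatorname{span}\{K(\cdot,y):y\in\Omega'\}$ is dense in $\mathcal{B}$.
   Context: $\Omega,\Omega'$ are locally compact Hausdorff spaces equipped with regular Borel measures $\mu,\mu'$. $L_0(X)$ denotes the set of real-valued measurable functions on $X$ (genuine functions). For a Banach space $\mathcal{B}$, $\mathcal{B}'$ is its continuous dual and $\langle f,G\rangle_{\mathcal{B}}:=G(f)$. Left-sided reproducing kernel Banach space: let $K\in L_0(\Omega\times\Omega')$ and let $\mathcal{B}$ be a Banach space consisting of functions in $L_0(\Omega)$ whose dual $\mathcal{B}'$ is isometrically isomorphic to a normed space $\mathcal{F}$ consisting of functions in $L_0(\Omega')$; $\mathcal{F}$ is fixed and identified with $\mathcal{B}'$. $\mathcal{B}$ is a left-sided reproducing kernel Banach space with left-sided reproducing kernel $K$ if $K(\cdot,y)\in\mathcal{B}$ for each $y\in\Omega'$, and $\langle K(\cdot,y),g\rangle_{\mathcal{B}}=g(y)$ for all $g\in\mathcal{F}\cong\mathcal{B}'$ and all $y\in\Omega'$. Here $\operatorname{span}$ denotes the set of all finite linear combinations. *)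

(* Defs.v *)
From HB Require Import structures.
From mathcomp Require Import all_boot all_order all_algebra.
From mathcomp Require Import all_classical all_reals all_analysis.
Set Implicit Arguments.
Unset Strict Implicit.
Unset Printing Implicit Defensive.
Import Order.TTheory GRing.Theory Num.Theory.
Import numFieldNormedType.Exports.
Local Open Scope classical_set_scope.
Local Open Scope ring_scope.

(* The product of pointed spaces is pointed and topological, but the library does
   not register the join. *)
HB.instance Definition _ (T U : ptopologicalType) := Pointed.on (T * U)%type.

(* Measurable types are pointed in MathComp-Analysis, hence the pointed
   topological spaces below. *)
Notation borel T := (g_sigma_algebraType (@open T)).

(* Finite on compact sets, outer regular on Borel sets, inner regular on open
   sets. *)
Definition regular_borel_measure (R : realType) (T : ptopologicalType)
    (mu : {measure set (borel T) -> \bar R}) : Prop :=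
  [/\ forall C : set T, compact C -> (mu C < +oo)%E,
      forall A : set T, measurable (A : set (borel T)) ->
        mu A = ereal_inf [set mu U | U in [set U : set T | open U /\ A `<=` U]]
    & forall U : set T, open U ->
        mu U =
        ereal_sup [set mu C | C in [set C : set T | compact C /\ C `<=` U]]].

(* Borel measurable functions; on a product space, the Borel sets of the product
   topology (a sigma-algebra containing the product of the Borel ones). *)
Definition L0 (R : realType) (T : ptopologicalType) : set (T -> R) :=
  [set f | measurable_fun setT (f : borel T -> R)].
Arguments L0 R T : clear implicits.

(* A normed space V consisting of functions in L0 R T is an abstract normed
   space with an injective linear evaluation map ev : V -> (T -> R); the norm of
   V is unrelated to any topology on T -> R. *)
Definition consists_of_L0_functions (R : realType) (T : ptopologicalType)
    (V : normedModType R) (ev : {linear V -> (T -> R^o)}) : Prop :=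
  injective ev /\ (forall v : V, L0 R T (ev v)).

Definition continuous_dual (R : realType) (V : normedModType R) :
    set (V -> R^o) :=
  [set G : V -> R^o | linear G /\ continuous G].
Arguments continuous_dual {R} V.

Definition dual_norm (R : realType) (V : normedModType R) (G : V -> R^o) : R :=
  sup [set `|G v| | v in [set v : V | `|v| <= 1]].

Definition dual_isometric_isomorphism (R : realType) (V F : normedModType R)
    (phi : {linear F -> (V -> R^o)}) : Prop :=
  set_bij [set: F] (continuous_dual V) phi /\
  (forall g : F, dual_norm (phi g) = `|g|).

(* phi g v is the pairing <v, g>. *)
Definition left_sided_RKBS (R : realType) (Omega Omega' : ptopologicalType)
    (K : Omega * Omega' -> R)
    (B : completeNormedModType R) (evB : {linear B -> (Omega -> R^o)})
    (F : normedModType R) (evF : {linear F -> (Omega' -> R^o)})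
    (phi : {linear F -> (B -> R^o)}) : Prop :=
  [/\ consists_of_L0_functions evB,
      consists_of_L0_functions evF,
      dual_isometric_isomorphism phi,
      forall y : Omega', exists k : B, evB k = (fun x => K (x, y))
    & forall (y : Omega') (k : B), evB k = (fun x => K (x, y)) ->
        forall g : F, phi g k = evF g y].

Definition kernel_sections (R : realType) (Omega Omega' : ptopologicalType)
    (K : Omega * Omega' -> R)
    (B : completeNormedModType R) (evB : {linear B -> (Omega -> R^o)}) :
    set B :=
  [set k | exists y : Omega', evB k = (fun x => K (x, y))].

Definition linear_span (R : realType) (V : lmodType R) (A : set V) : set V :=
  [set v | exists (n : nat) (c : 'I_n -> R) (a : 'I_n -> V),
     (forall i, A (a i)) /\ v = \sum_(i < n) c i *: a i].

(* Main.v *)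
(* A functional g in F that vanishes on every K(., y) satisfies
   g(y) = <K(., y), g> = 0 for all y, so g = 0; since F is the whole dual of B,
   the span has trivial annihilator and Hahn-Banach gives density.  Hahn-Banach
   is obtained in the Mazur-Orlicz form: Zorn's lemma yields a minimal sublinear
   functional below a given one, and minimal sublinear functionals are linear.
   To separate v0 from a subspace W at distance at least e, it is applied to the
   norm and the cone of pairs (t v0 - w, t e) with t >= 0 and w in W. *)
Require Import Defs.
From HB Require Import structures.
From mathcomp Require Import all_boot all_order all_algebra.
From mathcomp Require Import all_classical all_reals all_analysis.
From mathcomp Require Import lra.
Set Implicit Arguments.
Unset Strict Implicit.
Unset Printing Implicit Defensive.
Import Order.TTheory GRing.Theory Num.Theory.
Import numFieldNormedType.Exports.
Local Open Scope classical_set_scope.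
Local Open Scope ring_scope.

(** * Sublinear functionals and convex cones of constraints *)

(** Homogeneity is required as an inequality only: the converse for [a > 0] follows by scaling with
    the inverse of [a], and [a = 0] gives [p 0 <= 0]. *)
Definition sublinear {R : realType} {V : lmodType R} (p : V -> R) : Prop :=
  (forall x y, p (x + y) <= p x + p y) /\
  (forall a x, 0 <= a -> p (a *: x) <= a * p x).

(** A pair [C z b] encodes the constraint [b <= G z] on the linear functional [G] to be found. *)
Definition convex_cone {R : realType} {V : lmodType R} (C : V -> R -> Prop) :
    Prop :=
  [/\ C 0 0,
      forall z b z' b', C z b -> C z' b' -> C (z + z') (b + b')
    & forall a z b, 0 <= a -> C z b -> C (a *: z) (a * b)].

(* The largest sublinear functional q <= p such that q (- z) <= - b for every
   (z, b) in the cone C. *)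
Definition cone_minorant {R : realType} {V : lmodType R} (C : V -> R -> Prop)
    (p : V -> R) (x : V) : R :=
  inf [set r | exists z b, C z b /\ r = p (x + z) - b].

Section Sublinear.
Context {R : realType} {V : lmodType R}.
Implicit Types (p q : V -> R) (C : V -> R -> Prop).

Lemma sublinear0 p : sublinear p -> p 0 = 0.
Proof.
move=> [pD pZ]; have := pD 0 0; have := pZ 0 0 (lexx 0).
by rewrite scale0r addr0; lra.
Qed.

Lemma sublinear_geN p x : sublinear p -> - p (- x) <= p x.
Proof.
move=> sp; have := sp.1 x (- x); rewrite subrr sublinear0//; lra.
Qed.

Section ConeMinorant.
Context {C : V -> R -> Prop} {p : V -> R}.
Hypotheses (cC : convex_cone C) (sp : sublinear p)
  (Cp : forall z b, C z b -> b <= p z).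

Lemma cone_minorant_ge l x :
  (forall z b, C z b -> l <= p (x + z) - b) -> l <= cone_minorant C p x.
Proof.
move=> H; apply: lb_le_inf; last by move=> _ [z [b [Czb ->]]]; exact: H.
by exists (p (x + 0) - 0), 0, 0; split => //; case: cC.
Qed.

Lemma cone_minorant_le x z b : C z b -> cone_minorant C p x <= p (x + z) - b.
Proof.
move=> Czb; apply: ge_inf; last by exists z, b.
(* Lower bound for the infimum: [b' <= p z' <= p (- x) + p (x + z')]. *)
exists (- p (- x)) => _ [z' [b' [Czb' ->]]].
have := Cp Czb'; have := sp.1 (- x) (x + z').
by rewrite addKr; lra.
Qed.

Lemma cone_minorant_le_self x : cone_minorant C p x <= p x.
Proof.
have C0 : C 0 0 by case: cC.
by have := cone_minorant_le x C0; rewrite addr0 subr0.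
Qed.

Lemma cone_minorant_oppr z b : C z b -> cone_minorant C p (- z) <= - b.
Proof.
by move=> /(cone_minorant_le (- z)); rewrite addNr sublinear0// sub0r.
Qed.

Lemma cone_minorant_sublinear : sublinear (cone_minorant C p).
Proof.
have [_ CD CZ] := cC; split=> [x y|a x].
(* The two infima on the right are removed one at a time; the sum of the two chosen pairs is again
   in the cone and bounds the left side. *)
- rewrite -lerBlDr; apply: cone_minorant_ge => z b Czb.
  rewrite lerBlDr -lerBlDl; apply: cone_minorant_ge => z' b' Czb'.
  have := cone_minorant_le (x + y) (CD _ _ _ _ Czb Czb').
  by have := sp.1 (x + z) (y + z'); rewrite addrACA; lra.
- rewrite le_eqVlt => /predU1P[<-|a0].
    rewrite scale0r mul0r; apply: le_trans (cone_minorant_le_self _) _.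
    by rewrite sublinear0.
  rewrite -ler_pdivrMl//; apply: cone_minorant_ge => z b Czb.
  rewrite ler_pdivrMl//.
  have := cone_minorant_le (a *: x) (CZ _ _ _ (ltW a0) Czb).
  by have := sp.2 a (x + z) (ltW a0); rewrite scalerDr mulrBr; lra.
Qed.

End ConeMinorant.

(** * Minimal sublinear functionals *)

(** The pointwise infimum works: it is finite because every member is at least [- p (- x)] at [x],
    and totality of the chain yields subadditivity. *)
Lemma sublinear_chain_inf p (A : set (V -> R)) : A !=set0 ->
  (forall q, A q -> sublinear q /\ forall x, q x <= p x) ->
  total_on A (fun q q' => forall x, q' x <= q x) ->
  exists2 q, sublinear q & forall q', A q' -> forall x, q x <= q' x.
Proof.
move=> [q0 Aq0] Ap Atot; pose q x := inf [set q' x | q' in A].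
have qle q' x : A q' -> q x <= q' x.
  move=> Aq'; apply: ge_inf; last by exists q'.
  exists (- p (- x)) => _ [r Ar <-].
  have [sr rp] := Ap _ Ar.
  by apply: le_trans (sublinear_geN x sr); rewrite lerN2.
have qge l x : (forall q', A q' -> l <= q' x) -> l <= q x.
  move=> H; apply: lb_le_inf; first by exists (q0 x), q0.
  by move=> _ [r Ar <-]; exact: H.
exists q; last by move=> q' Aq' x; exact: qle.
split=> [x y|a x].
- rewrite -lerBlDr; apply: (qge) => q1 A1.
  rewrite lerBlDr -lerBlDl; apply: (qge) => q2 A2; rewrite lerBlDl.
  (* The smaller of [q1] and [q2] serves at both points: if [q2 <= q1], then
     [q2 (x + y) <= q2 x + q2 y <= q1 x + q2 y]. *)
  have [le21|le12] := Atot _ _ A1 A2.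
    have := (Ap _ A2).1.1 x y; have := le21 x; have := qle _ (x + y) A2; lra.
  have := (Ap _ A1).1.1 x y; have := le12 y; have := qle _ (x + y) A1; lra.
- rewrite le_eqVlt => /predU1P[<-|a0].
    apply: le_trans (qle _ _ Aq0) _.
    by rewrite scale0r mul0r sublinear0//; case: (Ap _ Aq0).
  rewrite -ler_pdivrMl//; apply: qge => r Ar; rewrite ler_pdivrMl//.
  exact: le_trans (qle _ _ Ar) ((Ap _ Ar).1.2 _ _ (ltW a0)).
Qed.

Lemma sublinear_minimal p : sublinear p ->
  exists q, [/\ sublinear q, forall x, q x <= p x
    & forall r, sublinear r -> (forall x, r x <= q x) -> forall x, q x <= r x].
Proof.
move=> sp; pose T := {q : V -> R | sublinear q /\ forall x, q x <= p x}.
(* The order is reversed, so that a maximal element for Zorn's lemma is a minimal functional. *)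
pose ge (s t : T) := `[< forall x, sval t x <= sval s x >].
have tp : sublinear p /\ forall x, p x <= p x by [].
have [||A Atot|t tmin] := @ZL_preorder T (exist _ p tp) ge.
- by move=> t; apply/asboolP.
- move=> r s t /asboolP rs /asboolP st; apply/asboolP => x.
  exact: le_trans (st x) (rs x).
- have [[s0 As0]|/set0P/negP/negPn/eqP A0] := pselect (A !=set0); last first.
    by exists (exist _ p tp) => s; rewrite A0.
  pose A' := [set sval s | s in A].
  have [|q' [s As <-]|q1 q2 [s1 As1 <-] [s2 As2 <-]|q sq qA] :=
      @sublinear_chain_inf p A'.
  + by exists (sval s0), s0.
  + exact: (svalP s).
  + by have [/asboolP|/asboolP] := Atot _ _ As1 As2; [left|right].
  have qp : sublinear q /\ forall x, q x <= p x.
    split=> // x; apply: le_trans ((svalP s0).2 x).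
    by apply: qA; exists s0.
  exists (exist _ q qp) => s As; apply/asboolP => x /=.
  by apply: qA; exists s.
case: t tmin => q [sq qp] tmin; exists q; split=> // r sr rq.
have rp : sublinear r /\ forall x, r x <= p x.
  by split=> // x; exact: le_trans (rq x) (qp x).
by apply/asboolP; apply: (tmin (exist _ r rp)); exact/asboolP.
Qed.

(* Minimality, applied to the cone spanned by (y, q y), gives
   q x <= q (x + y) - q y. *)
Lemma sublinear_minimal_linear q : sublinear q ->
  (forall r, sublinear r -> (forall x, r x <= q x) -> forall x, q x <= r x) ->
  linear (q : V -> R^o).
Proof.
move=> sq qmin.
have qD x y : q (x + y) = q x + q y.
  apply/le_anti; rewrite sq.1 /=.
  pose C (z : V) (b : R) := exists2 t, 0 <= t & z = t *: y /\ b = t * q y.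
  have cC : convex_cone C.
    split.
    - by exists 0 => //; rewrite scale0r mul0r.
    - move=> _ _ _ _ [t t0 [-> ->]] [s s0 [-> ->]].
      by exists (t + s); [exact: addr_ge0|rewrite scalerDl mulrDl].
    - move=> a _ _ a0 [t t0 [-> ->]].
      by exists (a * t); [exact: mulr_ge0|rewrite scalerA mulrA].
  have Cq z b : C z b -> b <= q z.
    move=> [t]; rewrite le_eqVlt => /predU1P[<- [-> ->]|t0 [-> ->]].
      by rewrite scale0r mul0r sublinear0.
    (* Scaling [t *: y] back by the inverse of [t] gives [t * q y <= q (t *: y)]. *)
    have := sq.2 t^-1 (t *: y); rewrite invr_ge0 => /(_ (ltW t0)).
    by rewrite scalerA mulVf ?gt_eqF// scale1r ler_pdivlMl.
  have Cy : C y (q y) by exists 1; rewrite ?scale1r ?mul1r.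
  have := qmin _ (cone_minorant_sublinear cC sq Cq)
    (cone_minorant_le_self cC sq Cq) x.
  by have := cone_minorant_le sq Cq x Cy; lra.
have qN x : q (- x) = - q x.
  by have := qD x (- x); rewrite subrr sublinear0//; lra.
have qZ0 a x : 0 <= a -> q (a *: x) = a * q x.
  move=> a0; apply/le_anti; rewrite sq.2//=.
  (* Since [q] is odd, the inequality at [- x] is the reverse inequality at [x]. *)
  by have := sq.2 a (- x) a0; rewrite scalerN !qN mulrN lerN2.
move=> a x y; rewrite qD; congr (_ + _).
have [/qZ0//|/ltW a0] := leP 0 a.
by rewrite -[a]opprK scaleNr qN qZ0 ?oppr_ge0// scaleNr.
Qed.

(** A minimal sublinear [G] below [cone_minorant C p] is linear, and [G (- z) <= - b] turns into
    [b <= G z]. *)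
Theorem mazur_orlicz C p : convex_cone C -> sublinear p ->
  (forall z b, C z b -> b <= p z) ->
  exists G : V -> R^o, [/\ linear G, forall x, G x <= p x
    & forall z b, C z b -> b <= G z].
Proof.
move=> cC sp Cp.
have [G [sG Gle Gmin]] := sublinear_minimal (cone_minorant_sublinear cC sp Cp).
exists G; split.
- exact: sublinear_minimal_linear.
- by move=> x; exact: le_trans (Gle x) (cone_minorant_le_self cC sp Cp x).
- move=> z b Czb.
  have := sublinear_geN z sG.
  have := Gle (- z); have := cone_minorant_oppr sp Cp Czb; lra.
Qed.

End Sublinear.

(** * Separation of a point from a subspace *)

Lemma norm_sublinear (R : realType) (V : normedModType R) :
  sublinear (fun x : V => `|x|).
Proof.
by split=> [|a x a0]; [exact: ler_normD|rewrite normrZ ger0_norm].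
Qed.

(** The bound at [x] and at [- x] makes [G] 1-Lipschitz. *)
Lemma linear_le_norm_continuous (R : realType) (V : normedModType R)
    (G : V -> R^o) :
  linear G -> (forall x, G x <= `|x|) -> continuous G.
Proof.
move=> linG Gle x; apply/cvgrPdist_lt => e e0.
have GB u v : G (u - v) = G u - G v.
  by rewrite addrC -scaleN1r linG scaleN1r addrC.
near=> y; apply: (@le_lt_trans _ _ `|x - y|).
  rewrite ler_norml -GB Gle andbT lerNl GB opprB -GB distrC; exact: Gle.
near: y; exact: cvgr_dist_lt.
Unshelve. all: by end_near. Qed.

(** If [W] misses a ball of radius [e] around [v0], Mazur-Orlicz gives a continuous [G] that
    vanishes on [W] with [e <= G v0], a contradiction. *)
Lemma dense_of_annihilator (R : realType) (V : normedModType R) (W : set V) :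
  W 0 -> (forall a u v, W u -> W v -> W (a *: u + v)) ->
  (forall G, continuous_dual V G -> (forall w, W w -> G w = 0) ->
    forall v, G v = 0) ->
  dense W.
Proof.
move=> W0 Wlin annW O [v0 Ov0] oO; apply/set0P/negP => /eqP OW0.
have /nbhs_ballP[e /= e0 eO] : nbhs v0 O by exact: open_nbhs_nbhs.
have We w : W w -> e <= `|v0 - w|.
  move=> Ww; rewrite leNgt; apply/negP => lte.
  suff : (O `&` W) w by rewrite OW0.
  by split=> //; apply: eO; rewrite -ball_normE.
have WZ a w : W w -> W (a *: w).
  by move=> Ww; rewrite -[_ *: _]addr0; exact: Wlin.
have WD u w : W u -> W w -> W (u + w).
  by move=> Wu Ww; rewrite -[u]scale1r; exact: Wlin.
pose C (z : V) (b : R) :=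
  exists t w, [/\ 0 <= t, W w, z = t *: v0 - w & b = t * e].
have cC : convex_cone C.
  split.
  - by exists 0, 0; split=> //; rewrite ?scale0r ?subr0 ?mul0r.
  - move=> _ _ _ _ [t [w [t0 Ww -> ->]]] [s [u [s0 Wu -> ->]]].
    exists (t + s), (w + u); split; [exact: addr_ge0|exact: WD| |].
      by rewrite scalerDl opprD addrACA.
    by rewrite mulrDl.
  - move=> a _ _ a0 [t [w [t0 Ww -> ->]]]; exists (a * t), (a *: w).
    split; [exact: mulr_ge0|exact: WZ| |by rewrite mulrA].
    by rewrite scalerBr scalerA.
have Cn z b : C z b -> b <= `|z|.
  move=> [t [w [+ Ww -> ->]]]; rewrite le_eqVlt => /predU1P[<-|t0].
    by rewrite mul0r.
  (* For [t > 0], the norm of [t *: v0 - w] is [t] times the distance from [v0] to [t^-1 *: w],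
     which lies in [W]. *)
  have := We _ (WZ t^-1 _ Ww); rewrite -(ler_pM2l t0) => /le_trans; apply.
  rewrite -{1}(gtr0_norm t0) -normrZ scalerBr scalerA mulfV ?gt_eqF//.
  by rewrite scale1r.
have [G [linG Gle GC]] := mazur_orlicz cC (norm_sublinear V) Cn.
(* Pairs with [t = 0] give a one-sided bound on [W]; as [W] is stable under negation, [G] vanishes
   there. *)
have G0 w : W w -> 0 <= G (- w).
  move=> Ww; apply: GC; exists 0, w.
  by rewrite scale0r mul0r sub0r.
have GN w : G (- w) = - G w.
  have G00 : G 0 = 0.
    by have := linG (-1) 0 0; rewrite scaleN1r oppr0 addr0 scaleN1r addNr.
  by have := linG (-1) w 0; rewrite !scaleN1r !addr0 G00 addr0.
have Gv0 : e <= G v0.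
  by apply: GC; exists 1, 0; rewrite scale1r subr0 mul1r.
suff Gv00 : G v0 = 0 by move: Gv0; rewrite Gv00 leNgt e0.
apply: annW.
  by split=> //; exact: linear_le_norm_continuous.
move=> w Ww; have := G0 _ Ww; have := G0 _ (WZ (-1) _ Ww).
rewrite scaleN1r opprK GN oppr_ge0 => G1 G2.
by apply/le_anti; rewrite G1 G2.
Qed.

(** * Linear spans *)

Section LinearSpan.
Context {R : realType} {V : lmodType R} (A : set V).

Lemma linear_span0 : linear_span A 0.
Proof.
exists 0%N, (fun=> 0), (fun=> 0); split; last by rewrite big_ord0.
by case.
Qed.

Lemma sub_linear_span : A `<=` linear_span A.
Proof.
move=> k Ak; exists 1%N, (fun=> 1), (fun=> k); split=> //.
by rewrite big_ord1 scale1r.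
Qed.

Lemma linear_span_linear a u v :
  linear_span A u -> linear_span A v -> linear_span A (a *: u + v).
Proof.
move=> [n [c [x [Ax ->]]]] [m [d [y [Ay ->]]]].
(* The two combinations are concatenated, with the coefficients of the first one scaled by [a]. *)
exists (n + m)%N,
  (fun i => match fintype.split i with inl j => a * c j | inr j => d j end),
  (fun i => match fintype.split i with inl j => x j | inr j => y j end).
split=> [i|]; first by case: fintype.split.
rewrite big_split_ord/= scaler_sumr; congr (_ + _); apply: eq_bigr => i _.
  by rewrite (unsplitK (inl _ i)) scalerA.
by rewrite (unsplitK (inr _ i)).
Qed.

End LinearSpan.

(** * Density of the span of the kernel sections *)

Theorem proposition2p5 (R : realType) (Omega Omega' : ptopologicalType)
    (lcO : locally_compact [set: Omega]) (hO : hausdorff_space Omega)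
    (lcO' : locally_compact [set: Omega']) (hO' : hausdorff_space Omega')
    (mu : {measure set (borel Omega) -> \bar R})
    (mu' : {measure set (borel Omega') -> \bar R})
    (rmu : regular_borel_measure mu) (rmu' : regular_borel_measure mu')
    (K : Omega * Omega' -> R) (mK : L0 R (Omega * Omega')%type K)
    (B : completeNormedModType R) (evB : {linear B -> (Omega -> R^o)})
    (F : normedModType R) (evF : {linear F -> (Omega' -> R^o)})
    (phi : {linear F -> (B -> R^o)}) :
  left_sided_RKBS K evB evF phi ->
  dense (linear_span (kernel_sections K evB)).
Proof.
move=> [_ [evF_inj _] [[_ _ phi_surj] _] Ksec Krep].
apply: dense_of_annihilator; [exact: linear_span0|exact: linear_span_linear|].
(* Surjectivity of [phi] represents [G] by an element [g] of [F], which injectivity of [evF] allows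
   to be tested pointwise. *)
move=> G dG GW v; have [g _ phig] := phi_surj G dG.
suff g0 : g = 0 by rewrite -phig g0 linear0.
apply: evF_inj; rewrite linear0; apply/funext => y.
have [k Kk] := Ksec y.
rewrite -(Krep y k Kk) phig; apply: GW.
by apply: sub_linear_span; exists y.
Qed.
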